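(* No non-Archimedean Polish group can have the Lévy property.
   Context: All topological spaces are assumed Hausdorff. A topological group is Polish if it is separable and completely metrizable; it is non-Archimedean if it admits a neighborhood basis of the identity consisting of open subgroups. A topological group $G$ has the Lévy property if there is an increasing sequence $(K_i)_{i\in\mathbb{N}}$ of compact subgroups of $G$, with normalized Haar measures $\mu_i$ on $K_i$ (regarded as measures on $G$), such that (i) $\bigcup_i K_i$ is dense in $G$, and (ii) for each open neighborhood $V$ of the identity of $G$ and each sequence of Borel sets $A_i\subseteq K_i$ with $\liminf_i\mu_i(A_i)>0$, one has $\lim_i\mu_i(VA_i)=1$.
   Formalization: The group is assumed nontrivial: the trivial group is Polish and non-Archimedean and has the Lévy property (take every K_i to be the trivial subgroup), so the claim fails for it; no other group is excluded. *)

(* Defs.v *)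
From HB Require Import structures.
From mathcomp Require Import all_boot all_order all_algebra.
From mathcomp Require Import all_classical all_reals all_analysis.

Set Implicit Arguments.
Unset Strict Implicit.
Unset Printing Implicit Defensive.

Local Open Scope classical_set_scope.
Local Open Scope group_scope.

(* MathComp-Analysis only provides additive (commutative) topological groups. *)
HB.structure Definition PreTopologicalGroup :=
  {G of Topological G & monoid.Group G}.

HB.mixin Record PreTopologicalGroup_isTopologicalGroup G
    & PreTopologicalGroup G := {
  mulg_continuous : continuous (fun x : G * G => x.1 * x.2) ;
  invg_continuous : continuous (fun x : G => x^-1)
}.

#[short(type="topologicalGroupType")]
HB.structure Definition TopologicalGroup :=
  {G of PreTopologicalGroup G & PreTopologicalGroup_isTopologicalGroup G}.

(* Generated sigma-algebras are only available on pointed types: the alias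
   [pointed1 G] is [G] pointed at its identity. *)
Definition pointed1 (G : topologicalGroupType) : Type := G.
HB.instance Definition _ (G : topologicalGroupType) :=
  TopologicalGroup.on (pointed1 G).
HB.instance Definition _ (G : topologicalGroupType) :=
  isPointed.Build (pointed1 G) (1 : G).

Definition borelType (G : topologicalGroupType) :=
  g_sigma_algebraType (@open (pointed1 G)).
HB.instance Definition _ (G : topologicalGroupType) :=
  Measurable.on (borelType G).

Definition separable (T : topologicalType) :=
  exists2 D : set T, countable D & dense D.

(* [T] is homeomorphic to a complete metric space. *)
Definition completely_metrizable (R : realType) (T : topologicalType) :=
  exists (M : metricType R) (f : T -> M) (g : M -> T),
    [/\ cancel f g, cancel g f, continuous f, continuous g &
        forall F : set_system M, ProperFilter F -> cauchy F ->
          exists x : M, F --> x].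

(* In particular the topology of a Polish group is Hausdorff. *)
Definition polish_group (R : realType) (G : topologicalGroupType) :=
  separable G /\ completely_metrizable R G.

Definition non_archimedean (G : topologicalGroupType) :=
  forall U : set G, nbhs 1 U ->
    exists H : set G, [/\ group_closed [in H], open H & H `<=` U].

(* The normalized Haar measure of a compact subgroup [K], regarded as a measure
   on the Borel sets of [G]: the regular Borel probability measure that is
   concentrated on [K] and invariant under left translations by [K]. *)
Definition is_normalized_haar (R : realType) (G : topologicalGroupType)
    (K : set G) (mu : probability (borelType G) R) :=
  [/\ mu K = 1%E,
      forall (g : G) (A : set (borelType G)), K g -> measurable A ->
        mu [set g * a | a in (A : set G)] = mu A &
      forall A : set (borelType G), measurable A ->
        mu A = ereal_sup [set mu C | C in
                            [set C : set G | compact C /\ C `<=` A]]].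

Definition levy_property (R : realType) (G : topologicalGroupType) :=
  exists (K : nat -> set G) (mu : nat -> probability (borelType G) R),
  [/\ forall i, compact (K i) /\ group_closed [in K i],
      forall i j, (i <= j)%N -> K i `<=` K j,
      forall i, is_normalized_haar (K i) (mu i),
      dense (\bigcup_i K i) &
      forall (V : set G) (A : nat -> set (borelType G)),
        open V -> V 1 ->
        (forall i, measurable (A i) /\ A i `<=` K i) ->
        (0 < limn_einf (fun i => mu i (A i)))%E ->
        mu i [set v * a | v in V & a in (A i : set G)] @[i --> \oo] --> 1%E].

(* Main.v *)
Require Import Defs.
From mathcomp Require Import all_boot all_order all_algebra.
From mathcomp Require Import all_classical all_reals all_analysis.
From mathcomp Require Import lra.
Import Order.TTheory GRing.Theory Num.Theory.

(** Let [H] be a proper open subgroup of [G]; one exists because [G] is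
    Hausdorff, nontrivial and non-Archimedean. If [K_i] is contained in [H] for
    every [i], then so is the union of the [K_i]; this union is dense, so it
    meets every coset of [H], which forces [H] to be [G]
    ([sub_open_subgroup]). Hence some [K_i] is not contained in [H], and
    neither are the later ones, the [K_i] being increasing.

    For such an [i], the open right cosets of [H] cut [K_i] into pieces, each of
    measure at most 1/2. A union of some of them therefore has a measure between
    1/4 and 3/4 ([haar_compact_splitting]). The part of that union inside [K_i]
    is taken as [A_i]. It is bounded away from 0 in measure, whereas the
    neighborhood [H] of the identity does not enlarge it beyond the union of
    cosets: [H A_i] has measure at most 3/4, which contradicts the Levy
    property.

    The bound 1/2 comes from left invariance. An open subgroup that does not
    contain [K_i] is disjoint from a left translate of itself by an element of
    [K_i], so it has measure at most 1/2 ([haar_open_subgroup_le_half]); and a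
    right coset [H k] is the left translate by [k] of the conjugate subgroup
    [k^-1 H k], to which this applies
    ([haar_open_rcoset_le_half]). *)

Local Open Scope group_scope.
Local Open Scope classical_set_scope.

(** Membership in [in H] unfolds only through boolean reflection; this form of
    the subgroup axioms applies to [H] as a predicate. *)
Lemma subgroup_closedP (G : topologicalGroupType) (H : set G) :
  group_closed [in H] <->
  [/\ H 1, forall x y, H x -> H y -> H (x * y) & forall x, H x -> H x^-1].
Proof.
split=> [Hgrp|[H1 HM HV]].
  split.
  - by have [+ _] := Hgrp; rewrite inE.
  - move=> x y Hx Hy; have /(_ x y) := group_closedM Hgrp.
    by rewrite !inE; apply.
  - by move=> x Hx; have /(_ x) := group_closedV Hgrp; rewrite !inE; apply.
split; first by rewrite inE.
by move=> x y; rewrite !inE => Hx Hy; apply/HM/HV.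
Qed.

Lemma continuous_mulgl (G : topologicalGroupType) (g : G) :
  continuous (fun x : G => g * x).
Proof.
move=> x; apply: (@continuous_comp G (G * G)%type G
  (fun y => (g, y)) (fun p => p.1 * p.2)).
- by apply: cvg_pair => /=; [exact: cvg_cst|exact: cvg_id].
- exact: mulg_continuous.
Qed.

Lemma continuous_mulgr (G : topologicalGroupType) (g : G) :
  continuous (fun x : G => x * g).
Proof.
move=> x; apply: (@continuous_comp G (G * G)%type G
  (fun y => (y, g)) (fun p => p.1 * p.2)).
- by apply: cvg_pair => /=; [exact: cvg_id|exact: cvg_cst].
- exact: mulg_continuous.
Qed.

Lemma lcosetE (G : topologicalGroupType) (g : G) (H : set G) :
  [set g * a | a in H] = (fun x => g^-1 * x) @^-1` H.
Proof.
apply/seteqP; split=> [_ [a Ha <-]|x /= Hx]; first by rewrite /= mulKg.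
by exists (g^-1 * x) => //; rewrite mulVKg.
Qed.

Lemma rcosetE (G : topologicalGroupType) (g : G) (H : set G) :
  [set a * g | a in H] = (fun x => x * g^-1) @^-1` H.
Proof.
apply/seteqP; split=> [_ [a Ha <-]|x /= Hx]; first by rewrite /= mulgK.
by exists (x * g^-1) => //; rewrite mulgVK.
Qed.

Lemma open_lcoset (G : topologicalGroupType) (g : G) (H : set G) :
  open H -> open [set g * a | a in H].
Proof.
by rewrite lcosetE; move: H; apply/continuousP/continuous_mulgl.
Qed.

Lemma open_rcoset (G : topologicalGroupType) (g : G) (H : set G) :
  open H -> open [set a * g | a in H].
Proof.
by rewrite rcosetE; move: H; apply/continuousP/continuous_mulgr.
Qed.

Lemma open_borel (G : topologicalGroupType) (U : set (borelType G)) :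
  open (U : set G) -> measurable U.
Proof. exact: sub_sigma_algebra. Qed.

Lemma closed_borel (G : topologicalGroupType) (C : set (borelType G)) :
  closed (C : set G) -> measurable C.
Proof.
move=> cC; rewrite -[C]setCK; apply: measurableC; apply: open_borel.
exact: closed_openC.
Qed.

Lemma lcoset_disjoint (G : topologicalGroupType) (H : set G) (g : G) :
  group_closed [in H] -> ~ H g -> H `&` [set g * a | a in H] = set0.
Proof.
move=> /subgroup_closedP[_ HM HV] NHg; rewrite -subset0 => x [Hx].
rewrite lcosetE /= => /HV; rewrite invgM invgK => /(HM _ _ Hx).
by rewrite mulVKg.
Qed.

(** A coset of [H] other than [H] would be a nonempty open set missing [D]. *)
Lemma sub_open_subgroup (G : topologicalGroupType) (D H : set G) :
  group_closed [in H] -> open H -> dense D -> D `<=` H -> H = setT.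
Proof.
move=> Hgrp Hop Ddense DH; rewrite -subTset => g _; apply: contrapT => NHg.
have [] := Ddense [set g * a | a in H].
- by exists (g * 1), 1 => //; have [] := (subgroup_closedP _ _).1 Hgrp.
- exact: open_lcoset.
- move=> x [gHx /DH Hx].
  have : set0 x by rewrite -(lcoset_disjoint _ _ _ Hgrp NHg).
  exact.
Qed.

Lemma inj_hausdorff (T U : topologicalType) (f : T -> U) :
  injective f -> continuous f -> hausdorff_space U -> hausdorff_space T.
Proof.
move=> finj fcont Uhaus p q pq; apply/finj/Uhaus => A B Afp Bfq.
by have [x [Ax Bx]] := pq _ _ (fcont _ _ Afp) (fcont _ _ Bfq); exists (f x).
Qed.

(** Dropping the members of the family one at a time lowers the measure of the
    union by at most [a] at each step, so the last union of measure at least [b]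
    exceeds [b] by at most [a]. *)
Lemma exists_subU_measure_bounded d (T : measurableType d) (R : realType)
    (mu : {measure set T -> \bar R}%R) (I : eqType) (F : I -> set T)
    (a b : \bar R) (s : seq I) :
  (0 <= a)%E -> (0 <= b)%E ->
  (forall i, i \in s -> measurable (F i) /\ (mu (F i) <= a)%E) ->
  (b <= mu (\big[setU/set0]_(i <- s) F i))%E ->
  exists2 t : seq I, {subset t <= s} &
    (b <= mu (\big[setU/set0]_(i <- t) F i) <= a + b)%E.
Proof.
move=> a0 b0; elim: s => [|i s IH] Fs.
  rewrite big_nil measure0 => b_le0; exists [::] => //.
  by rewrite big_nil measure0 b_le0 adde_ge0.
have Fs' : forall j, j \in s -> measurable (F j) /\ (mu (F j) <= a)%E.
  by move=> j js; apply: Fs; rewrite inE js orbT.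
have [/(IH Fs')[t ts tb] _|slt bs] := leP b (mu (\big[setU/set0]_(i <- s) F i)).
  by exists t => // j /ts js; rewrite inE js orbT.
exists (i :: s) => //; rewrite bs /=.
have [mFi Fia] := Fs i (mem_head _ _).
rewrite big_cons (le_trans (measureU2 _ mFi _)) ?leeD// ?ltW//.
by rewrite big_seq; apply: bigsetU_measurable => j /Fs'[].
Qed.

(** For [g] in [K] outside [L], the sets [L] and [g L] are disjoint and have the
    same measure, and the total mass is 1. *)
Lemma haar_open_subgroup_le_half (R : realType) (G : topologicalGroupType)
    (K : set G) (mu : probability (borelType G) R) (L : set G) :
  is_normalized_haar K mu -> group_closed [in L] -> open L -> ~ K `<=` L ->
  (mu L <= (2^-1)%:E)%E.
Proof.
move=> [_ muinv _] Lgrp Lop /existsNP[g /not_implyP[Kg NLg]].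
have mL : measurable (L : set (borelType G)) by exact: open_borel.
pose gL : set (borelType G) := [set g * a | a in L].
have mgL : measurable gL by apply: open_borel; exact: open_lcoset.
have mugL : mu gL = mu L by exact: muinv.
have muU : mu (L `|` gL) = (mu L + mu gL)%E.
  by apply: measureU => //; exact: lcoset_disjoint.
have : (mu (L `|` gL) <= 1)%E by apply: probability_le1; exact: measurableU.
rewrite muU mugL -(fineK (fin_num_measure mu _ mL)) -EFinD !lee_fin.
by move=> ?; lra.
Qed.

(** As [H k = k (k^-1 H k)], left invariance reduces the claim to the conjugate
    subgroup. It does not contain [K] either, since [K] is stable under
    conjugation by [k]. *)
Lemma haar_open_rcoset_le_half (R : realType) (G : topologicalGroupType)
    (K : set G) (mu : probability (borelType G) R) (H : set G) (k : G) :
  is_normalized_haar K mu -> group_closed [in K] -> group_closed [in H] ->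
  open H -> ~ K `<=` H -> K k -> (mu [set h * k | h in H]%g <= (2^-1)%:E)%E.
Proof.
move=> muK /subgroup_closedP[K1 KM KV] /subgroup_closedP[H1 HM HV] Hop NKH Kk.
pose L := [set k^-1 * x | x in [set h * k | h in H]].
have LE x : L x <-> H (k * x * k^-1).
  by rewrite /L lcosetE rcosetE /= invgK.
have Lop : open L by exact/open_lcoset/open_rcoset.
have <- : mu L = mu [set h * k | h in H].
  have [_ muinv _] := muK.
  by rewrite muinv; [|exact: KV|apply: open_borel; exact: open_rcoset].
apply: (haar_open_subgroup_le_half _ _ _ _ _ muK) => //.
  apply/subgroup_closedP; split=> [|x y|x]; rewrite !LE.
  - by rewrite mulg1 mulgV.
  - by move=> Hx /(HM _ _ Hx); rewrite !mulgA mulgVK.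
  - by move=> /HV; rewrite !invgM invgK mulgA.
move=> KL; apply: NKH => x Kx.
have /KL/LE := KM _ _ (KM _ _ (KV _ Kk) Kx) Kk.
by rewrite !mulgA mulgV mul1g mulgK.
Qed.

(** By compactness finitely many right cosets [H k] with [k] in [K] cover [K].
    Each has measure at most 1/2, so some of them have a union of measure
    between 1/4 and 1/4 + 1/2. That union is invariant under left multiplication
    by [H], and its trace on [K] has the same measure. *)
Lemma haar_compact_splitting (R : realType) (G : topologicalGroupType)
    (K : set G) (mu : probability (borelType G) R) (H : set G) :
  hausdorff_space G -> compact K -> group_closed [in K] ->
  is_normalized_haar K mu -> group_closed [in H] -> open H -> ~ K `<=` H ->
  exists A : set (borelType G),
    [/\ measurable A, A `<=` K, ((4^-1)%:E <= mu A)%E &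
        (mu [set h * a | h in H & a in (A : set G)]%g <= (3 / 4)%:E)%E].
Proof.
move=> Ghaus Kcpt Kgrp muK Hgrp Hop NKH.
have [muK1 _ _] := muK.
have [H1 HM HV] := (subgroup_closedP _ _).1 Hgrp.
have mK : measurable (K : set (borelType G)).
  by apply: closed_borel; exact: compact_closed.
pose F (k : G) : set (borelType G) := [set h * k | h in H].
have Fop k : open (F k : set G) by exact: open_rcoset.
have mF k : measurable (F k) by exact: open_borel.
(* Compact subsets of a pointed space are covering compact; [G] is pointed at
   its identity. *)
have /(_ G K F (fun k _ => Fop k)) : cover_compact K.
  have : cover_compact (K : set (pointed1 G)) by rewrite -compact_cover.
  exact.
case; first by move=> k Kk; exists k => //; exists 1; rewrite ?mul1g.
move=> s sK Ks.
pose U (t : seq G) := \big[setU/set0]_(k <- t) F k.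
have mU t : measurable (U t) by exact: bigsetU_measurable.
have KU : K `<=` U (finmap.enum_fset s) by rewrite /U -bigcup_seq.
have [||||t ts /andP[lt tl]] :=
    @exists_subU_measure_bounded _ _ _ mu _ F (2^-1)%:E (4^-1)%:E
      (finmap.enum_fset s).
- by rewrite lee_fin invr_ge0.
- by rewrite lee_fin invr_ge0.
- move=> k /sK; rewrite inE => Kk; split; first exact: mF.
  exact: haar_open_rcoset_le_half Kk.
- apply: (@le_trans _ _ (mu K)); first by rewrite muK1 lee_fin; lra.
  by apply: le_measure; rewrite ?inE; [exact: mK|exact: mU|].
have UK0 : mu (~` K) = 0%E.
  by rewrite probability_setC// muK1 subee.
have mKC : measurable (~` K : set (borelType G)) by exact: measurableC.
have mUK : measurable (U t `&` K) by exact: measurableI.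
exists (U t `&` K); split => //.
- apply: (le_trans lt); apply: (@le_trans _ _ (mu ((U t `&` K) `|` ~` K))).
    apply: le_measure; rewrite ?inE; [exact: mU|exact: measurableU|].
    by move=> x Ux; have [Kx|NKx] := pselect (K x); [left|right].
  by rewrite -[leRHS]adde0 -UK0; exact: measureU2.
- (* The representatives [k] of the cosets in [U t] lie in [K], so multiplying
     the trace by [H] recovers the whole union. *)
  have -> : [set h * a | h in H & a in (U t `&` K : set G)] = U t.
    rewrite /U -bigcup_seq; apply/seteqP; split.
      move=> _ [h Hh [a [[k kt [h' Hh' <-]] Ka]] <-].
      by exists k => //; exists (h * h'); [exact: HM|rewrite mulgA].
    move=> _ [k kt [h Hh <-]]; exists h => //; exists k => //; split.
      by exists k => //; exists 1 => //; rewrite mul1g.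
    by have /sK := ts _ kt; rewrite inE.
  by rewrite (le_trans tl)// -EFinD lee_fin; lra.
Qed.

Lemma limn_einf_ge (R : realType) (u : (\bar R)^nat) (c : \bar R) :
  (\forall n \near \oo, (c <= u n)%E) -> (c <= limn_einf u)%E.
Proof.
move=> [N _ cu]; rewrite limn_einf_lim; apply: lime_ge.
  exact: is_cvg_einfs.
exists N => // n /= Nn; apply: le_ereal_inf_tmp => _ [k /= nk <-].
by apply: cu => /=; exact: leq_trans nk.
Qed.

Theorem corollary3p7 (R : realType) (G : topologicalGroupType)
    (hpolish : polish_group R G) (hna : non_archimedean G)
    (hnontrivial : exists g : G, g <> 1) :
  ~ levy_property R G.
Proof.
have lt34 : ~~ (1 <= 3 / 4 :> R)%R by rewrite -ltNge; lra.
move=> [K [mu [Kcpt Kmono muK Kdense levy]]].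
have Ghaus : hausdorff_space G.
  have [_ [M [f [g [fK _ fcont _ _]]]]] := hpolish.
  exact: (inj_hausdorff _ _ f (can_inj fK) fcont (@metric_hausdorff R M)).
have [g0 g0N1] := hnontrivial.
have [H [Hgrp Hop Hg0]] : exists H : set G,
    [/\ group_closed [in H], open H & H `<=` ~` [set g0]].
  apply: hna; apply: open_nbhs_nbhs; split; last by move=> /esym.
  exact/closed_openC/accessible_closed_set1/hausdorff_accessible.
have [i0 NKH] : exists i0, ~ K i0 `<=` H.
  apply: contrapT => /forallNP KH.
  have HT : H = setT.
    apply: (sub_open_subgroup _ _ _ Hgrp Hop Kdense) => x [i _ Kix].
    by have /contrapT := KH i; apply.
  by have /(_ g0) := Hg0; rewrite HT; apply.
pose split_by_H i (B : set (borelType G)) :=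
  ((4^-1)%:E <= mu i B)%E /\
  (mu i [set h * a | h in H & a in (B : set G)]%g <= (3 / 4)%:E)%E.
have /choice[A AP] : forall i, exists B : set (borelType G),
    [/\ measurable B, B `<=` K i & (i0 <= i)%N -> split_by_H i B].
  move=> i; case: (leqP i0 i) => [i0i|_].
    have [] := @haar_compact_splitting R G (K i) (mu i) H Ghaus _ _ _ Hgrp Hop.
    - by have [] := Kcpt i.
    - by have [] := Kcpt i.
    - exact: muK.
    - by move=> KiH; apply: NKH; exact: subset_trans (Kmono _ _ i0i) KiH.
    - by move=> B [mB BK B1 B2]; exists B; split.
  (* Finitely many indices do not matter: any Borel subset of [K i] will do. *)
  by exists set0; split.
have H1 : H 1 by have [] := (subgroup_closedP _ _).1 Hgrp.
suff : (1%:E <= (3 / 4 : R)%:E)%E by rewrite lee_fin; apply/negP.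
apply: (cvge_to_le (levy H A Hop H1 _ _)).
- by move=> i; have [] := AP i.
- apply: (@lt_le_trans _ _ (4^-1)%:E); first by rewrite lte_fin invr_gt0.
  apply: limn_einf_ge; exists i0 => // i /= i0i.
  by have [_ _ /(_ i0i)[]] := AP i.
- by exists i0 => // i /= i0i; have [_ _ /(_ i0i)[]] := AP i.
Qed.
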